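(* Let $\rho>0$ and let $A,B\in\mathbb{R}^{n\times n}$ be in the block form described in the context, with $d=\operatorname{rank}(B)$. (i) There exist $d$ continuous functions $\gamma_1,\dots,\gamma_d:\mathbb{R}\to\mathbb{R}\cup\{-\infty,\infty\}$ such that $$\mathcal{A}_c=\bigcup_{\ell=1}^d\{\gamma_\ell(\omega)+i\omega:\ \omega\in\mathbb{R},\ \gamma_\ell(\omega)\notin\{-\infty,\infty\}\}$$ (they are called the spectral curves of $\mathcal{A}_c$), and these functions have the following properties. (ii) Let $\omega\in\mathcal{W}$. Then there exists $\ell\in\{1,\dots,d\}$ such that $\gamma_\ell(\omega)=\infty$ if and only if $i\omega\in\sigma(A)$. (iii) Let $\omega\in\mathbb{R}$ with $i\omega\notin\sigma(A)$ and $\rho\omega\ne k\pi$ for all $k\in\mathbb{Z}\setminus\{0\}$, and let $d<n$. Then there exists $\ell\in\{1,\dots,d\}$ such that $\gamma_\ell(\omega)=-\infty$ if and only if $i\omega\in\sigma(A_1)$.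
   Context: Block form: $B=\begin{bmatrix}0&0\\ 0&\bar B\end{bmatrix}$ with $\bar B\in\mathbb{R}^{d\times d}$ invertible, $1\le d\le n$, and $A=\begin{bmatrix}A_1&A_2\\ A_3&A_4\end{bmatrix}$ with $A_1\in\mathbb{R}^{(n-d)\times(n-d)}$, $A_4\in\mathbb{R}^{d\times d}$ (if $d=n$, $A_1$ is empty and $\sigma(A_1)=\emptyset$). $\sigma(M)$ is the set of eigenvalues of $M$. $\mathrm{sinc}(x)=\sin(x)/x$ for $x\neq0$, $\mathrm{sinc}(0)=1$. $p_\omega(x)=\det\left(i\omega I_n-A-x\,\mathrm{sinc}(\rho\omega)\,B\right)$, a polynomial in $x$, for $\omega\in\mathbb{R}$. $\mathcal{W}=\{\omega\in\mathbb{R}: i\omega\notin\sigma(A_1)\text{ and }\rho\omega\ne k\pi\text{ for all }k\in\mathbb{Z}\setminus\{0\}\}$. Strong critical spectrum: $\mathcal{A}_0=\{i\omega:\omega\in\mathbb{R},\ i\omega\in\sigma(A)\text{ and }p_\omega(x)=0\text{ for all }x\in\mathbb{C}\}$. Asymptotic continuous spectrum: $\mathcal{A}_c=\mathrm{closure}\{\gamma+i\omega\in\mathbb{C}:\gamma,\omega\in\mathbb{R},\ i\omega\notin\mathcal{A}_0\text{ and }\exists\varphi\in\mathbb{R}:\ p_\omega(e^{-\gamma}e^{-i\varphi})=0\}$. Continuity of the $\gamma_\ell$ is with respect to the usual topology of the extended real line $\mathbb{R}\cup\{-\infty,\infty\}$. *)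

(* Defs.v *)
From mathcomp Require Import all_boot all_order all_algebra.
From mathcomp Require Import complex.
From mathcomp Require Import all_classical all_reals all_analysis.

Set Implicit Arguments.
Unset Strict Implicit.
Unset Printing Implicit Defensive.

Import Order.TTheory GRing.Theory Num.Theory.
Import numFieldNormedType.Exports.

Local Open Scope classical_set_scope.
Local Open Scope ring_scope.
Local Open Scope complex_scope.

Section Defs.
Variable R : realType.

(* [R[i]] as a [numFieldType], so that [set Cx] carries the topology of the
   complex modulus; Rocq does not find that topology on the bare type [R[i]]. *)
Definition Cx : numFieldType := R[i].

Definition complexify m n (M : 'M[R]_(m, n)) : 'M[R[i]]_(m, n) :=
  map_mx (real_complex R) M.

Definition spectrum n (M : 'M[R]_n) : set R[i] :=
  [set z | eigenvalue (complexify M) z].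

Definition sinc (x : R) : R := if x == 0 then 1 else sin x / x.

(* exp(i t), by Euler's formula *)
Definition expi (t : R) : R[i] := cos t +i* sin t.

Definition imag (omega : R) : R[i] := 0 +i* omega.

Definition p_ n (rho : R) (A B : 'M[R]_n) (omega : R) (x : R[i]) : R[i] :=
  \det ((imag omega)%:M - complexify A
        - (x * (sinc (rho * omega))%:C) *: complexify B).

Definition strong_critical_spectrum n (rho : R) (A B : 'M[R]_n) : set R[i] :=
  [set imag omega | omega in
    [set omega | spectrum A (imag omega) /\
                 forall x : R[i], p_ rho A B omega x = 0]].

Definition asymptotic_continuous_spectrum n (rho : R) (A B : 'M[R]_n) :
    set Cx :=
  closure ([set z | exists gamma omega : R,
    [/\ z = gamma +i* omega,
        ~ strong_critical_spectrum rho A B (imag omega) &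
        exists phi : R,
          p_ rho A B omega ((expR (- gamma))%:C * expi (- phi)) = 0]]
    : set Cx).

Definition nonresonant (rho omega : R) : Prop :=
  forall k : int, k != 0 -> rho * omega != k%:~R * pi.

(* The set W; [A1] is the upper left (n - d) x (n - d) block of A. When d = n it
   is the empty matrix, whose [spectrum] is empty. *)
Definition regular_frequencies m (rho : R) (A1 : 'M[R]_m) : set R :=
  [set omega | ~ spectrum A1 (imag omega) /\ nonresonant rho omega].

Definition spectral_curve (gamma : R -> \bar R) : set R[i] :=
  [set fine (gamma omega) +i* omega | omega in
    [set omega | gamma omega \is a fin_num]].

End Defs.

(* Main.v *)
Require Import Defs.
From mathcomp Require Import all_boot all_order all_algebra.
From mathcomp Require Import perm zify ring lra complex.
From mathcomp Require Import all_classical all_reals all_analysis.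

Set Implicit Arguments.
Unset Strict Implicit.
Unset Printing Implicit Defensive.

Import Order.TTheory GRing.Theory Num.Theory.
Import numFieldNormedType.Exports.

Local Open Scope classical_set_scope.
Local Open Scope ring_scope.
Local Open Scope complex_scope.

(* Put [Q(omega, y) = det (i omega - A - y B)], so that [p_omega(x) = Q(omega, sinc(rho omega) x)].
   It has degree at most [d] in [y], and [y^d] has coefficient [det (i omega - A1) det (- Bbar)].
   The zeros of [sinc(rho omega)] are simple, so it equals a polynomial carrying its zeros among
   the zeros of [det (i omega - A)], times a continuous function that is nonzero there. Dividing the
   resulting polynomial coefficients by their common factor [g] gives
   [p_omega(x) = g(i omega) f_omega(x)], where [f_omega] has continuous coefficients and is never
   the zero polynomial. Seen as a binary form of degree [d], [f_omega] has [d] zeros on the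
   projective line, and the curve [gamma_l] is the [l]-th smallest of the values [- ln |x|].
   These order statistics are continuous: by deflation, the number of zeros in an open disc is
   lower semicontinuous, and the same holds near infinity for the reciprocal polynomial.
   The points [i omega] of the strong critical spectrum are the finitely many with
   [g(i omega) = 0], and taking the closure restores the curves over these frequencies. *)

(** * Convergence of roots *)

Section RootConvergence.
Variable C : numClosedFieldType.
Implicit Types (p q : {poly C}) (s : seq C).

(** Every root [z] satisfies [|w - z| <= |a - z| + |w - a| <= |a - z| (1 + |w - a| / e)], and the
    bound multiplies over at most [N] linear factors. Read backwards, a value at [a] much smaller
    than the value at [w] forces a root within [e] of [a]. *)
Lemma horner_le_far_roots p N (a w e : C) :
  0 < e -> (size p <= N.+1)%N -> (forall z, root p z -> e <= `|a - z|) ->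
  `|p.[w]| <= `|p.[a]| * (1 + `|w - a| / e) ^+ N.
Proof.
move=> e0; have [->|p0] := eqVneq p 0; first by rewrite !horner0 normr0 mul0r.
have [s Dp] := closed_field_poly_normal p.
have lp0 : lead_coef p != 0 by rewrite lead_coef_eq0.
rewrite Dp size_scale // size_prod_XsubC => sN far.
set K := 1 + _; have K1 : 1 <= K by rewrite lerDl divr_ge0 // ltW.
have {}far z : z \in s -> e <= `|a - z|.
  by move=> zs; apply: far; rewrite rootZ // root_prod_XsubC.
rewrite !hornerZ !normrM -mulrA ler_wpM2l //.
apply: (@le_trans _ _ (`|(\prod_(z <- s) ('X - z%:P)).[a]| * K ^+ size s)); last first.
  by rewrite ler_wpM2l // ler_weXn2l.
elim: s far {sN Dp} => [|z s IH] far.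
  by rewrite !big_nil !hornerE normr1.
rewrite !big_cons !hornerM !normrM exprS mulrACA ler_pM //; last first.
  by apply: IH => y ys; apply: far; rewrite in_cons ys orbT.
rewrite !hornerXsubC mulrDr mulr1.
have -> : w - z = (a - z) + (w - a) by rewrite [RHS]addrC addrA subrK.
apply: (le_trans (ler_normD _ _)); rewrite lerD2l mulrCA ler_peMr //.
by rewrite ler_pdivlMr // mul1r far // mem_head.
Qed.

Lemma nearest_root p (a : C) : p != 0 -> (exists w, root p w) ->
  exists w, root p w /\ forall z, root p z -> `|w - a| <= `|z - a|.
Proof.
move=> p0 [w0 rw0]; have [s Dp] := closed_field_poly_normal p.
have rE z : root p z = (z \in s).
  by rewrite Dp rootZ ?lead_coef_eq0 // root_prod_XsubC.
have : s != [::] by apply: contraTneq rw0 => s0; rewrite rE s0.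
suff H : s != [::] -> exists2 w, w \in s & forall z, z \in s -> `|w - a| <= `|z - a|.
  by move=> /H[w ws wm]; exists w; rewrite rE; split=> // z; rewrite rE; exact: wm.
elim: s {Dp rE} => // x [|y s] IH _.
  by exists x; rewrite ?mem_head // => z; rewrite mem_seq1 => /eqP->.
have [//|w ws wm] := IH.
have /orP[le|le] := real_leVge (normr_real (x - a)) (normr_real (w - a)).
  exists x; first by rewrite mem_head.
  move=> z; rewrite in_cons => /predU1P[->//|zs].
  exact: le_trans le (wm z zs).
exists w; first by rewrite in_cons ws orbT.
by move=> z; rewrite in_cons => /predU1P[->//|]; exact: wm.
Qed.

Section Filter.
Context {T : Type} {F : set_system T} {FF : Filter F}.

Lemma cvg_horner (p_ : T -> {poly C}) p N (a : C) :
  (forall t, (size (p_ t) <= N)%N) -> (size p <= N)%N ->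
  (forall i, (p_ t)`_i @[t --> F] --> p`_i) ->
  (p_ t).[a] @[t --> F] --> p.[a].
Proof.
move=> sp_ sp cvp; rewrite (horner_coef_wide _ sp).
under eq_fun do rewrite (horner_coef_wide _ (sp_ _)).
apply: cvg_big => [|i _]; first exact: add_continuous.
by apply: cvgM => //; exact: cvg_cst.
Qed.

(** At a point [w] with [p.[w] != 0] the values of [p_ t] stay away from 0, while those at [a] tend
    to 0; by [horner_le_far_roots] some root of [p_ t] lies arbitrarily close to [a]. *)
Lemma cvg_near_root (p_ : T -> {poly C}) p N (a : C) :
  (forall t, (size (p_ t) <= N)%N) -> (size p <= N)%N -> p != 0 ->
  (forall i, (p_ t)`_i @[t --> F] --> p`_i) -> root p a ->
  exists z_ : T -> C, z_ t @[t --> F] --> a /\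
    \forall t \near F, root (p_ t) (z_ t).
Proof.
move=> sp_ sp p0 cvp ra.
have /closed_nonrootP[w rw] := p0.
have pw0 : 0 < `|p.[w]| by rewrite normr_gt0.
have close (e : C) : 0 < e ->
    \forall t \near F, p_ t != 0 /\ exists2 z, root (p_ t) z & `|z - a| < e.
  move=> e0; set K := (1 + `|w - a| / e) ^+ N.
  have K0 : 0 < K by rewrite exprn_gt0 // ltr_pwDl // divr_ge0 // ltW.
  have /cvgrPdist_lt ca := cvg_horner (a := a) sp_ sp cvp.
  have /cvgrPdist_lt cw := cvg_horner (a := w) sp_ sp cvp.
  have e1 : 0 < `|p.[w]| / 2 / K by rewrite !divr_gt0.
  have e2 : 0 < `|p.[w]| / 2 by rewrite !divr_gt0.
  near=> t.
  have ha : `|(p_ t).[a]| * K < `|p.[w]| / 2.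
    rewrite -ltr_pdivlMr //; have : `|p.[a] - (p_ t).[a]| < `|p.[w]| / 2 / K.
      by near: t; exact: ca.
    by rewrite (eqP ra) sub0r normrN.
  have hw : `|p.[w] - (p_ t).[w]| < `|p.[w]| / 2 by near: t; exact: cw.
  have hw2 : `|p.[w]| / 2 < `|(p_ t).[w]|.
    rewrite -(ltrD2l (`|p.[w]| / 2)) -splitr.
    apply: (@le_lt_trans _ _ (`|p.[w] - (p_ t).[w]| + `|(p_ t).[w]|)).
      by rewrite -{1}(subrK (p_ t).[w] p.[w]) ler_normD.
    by rewrite ltrD2r.
  split.
    by apply: contraTneq hw2 => ->; rewrite horner0 normr0 -real_leNgt ?normr_real ?ltW // ger0_real ?ltW.
  apply: contrapT => far.
  suff : `|(p_ t).[w]| <= `|(p_ t).[a]| * K.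
    move=> /(lt_le_trans hw2) /(lt_trans ha).
    by rewrite ltxx.
  apply: horner_le_far_roots => //; first by rewrite (leq_trans (sp_ t)).
  move=> z rz; rewrite distrC real_leNgt ?normr_real ?gtr0_real //.
  by apply/negP => lt; apply: far; exists z.
(* Taking a root nearest to [a] gives one choice of root that serves every [e]. The default [a] of
   [xget] is met only where [p_ t] is zero or has no root, which near [F] does not happen. *)
pose Q t := [set y | root (p_ t) y /\ forall z, root (p_ t) z -> `|y - a| <= `|z - a|].
exists (fun t => xget a (Q t)).
have good t : p_ t != 0 -> (exists z, root (p_ t) z) -> Q t (xget a (Q t)).
  by move=> /nearest_root/[apply] /(_ a)[y Qy]; apply: (xgetI a Qy).
split.
  apply/cvgrPdist_lt => e e0; near=> t.
  have [pt0 [z rz ze]] : p_ t != 0 /\ exists2 z, root (p_ t) z & `|z - a| < e.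
    by near: t; exact: close.
  rewrite distrC; apply: le_lt_trans ze.
  by have [_ /(_ z rz)] := good t pt0 (ex_intro _ z rz).
near=> t.
have [pt0 [z rz _]] : p_ t != 0 /\ exists2 z, root (p_ t) z & `|z - a| < 1.
  by near: t; exact: (close 1).
by have [] := good t pt0 (ex_intro _ z rz).
Unshelve. all: by end_near. Qed.

(** Synthetic division: each coefficient of the quotient is a coefficient of the product plus the
    root times the next higher coefficient of the quotient. Convergence thus descends from index
    [N], where all coefficients vanish. *)
Lemma cvg_deflate (q_ : T -> {poly C}) q N (z_ : T -> C) (a : C) :
  (forall t, (size (q_ t) <= N)%N) -> (size q <= N)%N ->
  z_ t @[t --> F] --> a ->
  (forall i, (('X - (z_ t)%:P) * q_ t)`_i @[t --> F] --> (('X - a%:P) * q)`_i) ->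
  forall i, (q_ t)`_i @[t --> F] --> q`_i.
Proof.
move=> sq_ sq cvz cvp i.
have : forall k, (N <= i + k)%N -> (q_ t)`_i @[t --> F] --> q`_i.
  move=> k; elim: k i => [|k IH] i Nik.
    rewrite addn0 in Nik; rewrite (nth_default 0 (leq_trans sq Nik)).
    under eq_fun do rewrite (nth_default 0 (leq_trans (sq_ _) Nik)).
    exact: cvg_cst.
  have coefE z (r : {poly C}) : r`_i = (('X - z%:P) * r)`_i.+1 + z * r`_i.+1.
    by rewrite mulrBl coefB coefXM coefCM /= subrK.
  rewrite (coefE a).
  rewrite (_ : (fun t => (q_ t)`_i) =
    (fun t => (('X - (z_ t)%:P) * q_ t)`_i.+1 + z_ t * (q_ t)`_i.+1)); last first.
    by apply/funext => t; exact: coefE.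
  apply: cvgD; first exact: cvp.
  by apply: cvgM => //; apply: IH; rewrite addSnnS.
by apply; exact: leq_addl.
Qed.

(* Roots of the limit in the open disc attract as many roots of [p_ t]: one root at a time, by deflation. *)
Lemma cvg_roots_in_disc s N (r : C) (p_ : T -> {poly C}) q :
  (forall t, (size (p_ t) <= N)%N) -> q != 0 ->
  (size (\prod_(z <- s) ('X - z%:P) * q)%R <= N)%N ->
  (forall i, (p_ t)`_i @[t --> F] --> (\prod_(z <- s) ('X - z%:P) * q)`_i) ->
  all (fun z => `|z| < r) s ->
  \forall t \near F, exists s' q', [/\ p_ t = \prod_(z <- s') ('X - z%:P) * q',
     size s' = size s & all (fun z => `|z| < r) s'].
Proof.
elim: s N p_ => [|a s IH] N p_ sp_ q0 sp cvp.
  by move=> _; near=> t; exists [::], (p_ t); rewrite big_nil mul1r.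
move=> /= /andP[ar alls].
set g := \prod_(z <- s) ('X - z%:P) * q.
have pE : \prod_(z <- a :: s) ('X - z%:P) * q = ('X - a%:P) * g.
  by rewrite big_cons mulrA.
rewrite pE in sp cvp.
have g0 : g != 0.
  by rewrite mulf_neq0 // monic_neq0 // monic_prod_XsubC.
have p0 : ('X - a%:P) * g != 0 by rewrite mulf_neq0 // polyXsubC_eq0.
have ra : root (('X - a%:P) * g) a by rewrite rootM root_XsubC eqxx.
have [z_ [cvz rz]] := cvg_near_root sp_ sp p0 cvp ra.
pose q_ t := p_ t %/ ('X - (z_ t)%:P).
have q_E : \forall t \near F, p_ t = ('X - (z_ t)%:P) * q_ t.
  near=> t; rewrite mulrC divpK // dvdp_XsubCl.
  by near: t.
have sq_ t : (size (q_ t) <= N)%N by rewrite (leq_trans (leq_divp _ _)).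
have sg : (size g <= N)%N.
  by apply: leq_trans sp; rewrite size_monicM ?monicXsubC // size_XsubC.
have cvq : forall i, (q_ t)`_i @[t --> F] --> g`_i.
  apply: (cvg_deflate sq_ sg cvz) => i; apply: cvg_trans (cvp i).
  apply: near_eq_cvg.
  by apply: filterS q_E => t ->.
have IHq := IH N q_ sq_ q0 sg cvq alls.
have zr : \forall t \near F, `|z_ t| < r.
  have /cvgrPdist_lt := cvz; rewrite -subr_gt0 in ar.
  move=> /(_ _ ar); apply: filterS => t lt.
  rewrite -(ltrD2l (- `|a|)) addrC (addrC _ r) ; apply: le_lt_trans lt.
  by rewrite distrC lerB_dist.
near=> t.
have [s' [q' [Eq ss' alls']]] : exists s' q',
    [/\ q_ t = \prod_(z <- s') ('X - z%:P) * q', size s' = size s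
       & all (fun z => `|z| < r) s'] by near: t.
exists (z_ t :: s'), q'; split => /=; last 2 first.
- by rewrite ss'.
- by rewrite alls' andbT; near: t.
rewrite big_cons -mulrA -Eq.
by near: t.
Unshelve. all: by end_near. Qed.

Lemma cvg_root_count N (r : C) (p_ : T -> {poly C}) p (R_ : T -> seq C) s :
  (forall t, (size (p_ t) <= N)%N) -> p != 0 -> (size p <= N)%N ->
  (forall i, (p_ t)`_i @[t --> F] --> p`_i) ->
  (forall t, p_ t != 0) ->
  (forall t, p_ t = lead_coef (p_ t) *: \prod_(z <- R_ t) ('X - z%:P)) ->
  p = lead_coef p *: \prod_(z <- s) ('X - z%:P) ->
  \forall t \near F,
    (count (fun z => (`|z| < r)%R) s <= count (fun z => (`|z| < r)%R) (R_ t))%N.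
Proof.
move=> sp_ p0 sp cvp p_0 DR Ds.
set P := fun z : C => `|z| < r.
(* [q] collects the roots of [p] outside the disc, so the deflation lemma applies to the inner roots
   alone. By unique factorization the roots it finds form a sub-multiset of [R_ t]. *)
pose q := lead_coef p *: \prod_(z <- seq.filter (predC P) s) ('X - z%:P).
have pE : p = \prod_(z <- seq.filter P s) ('X - z%:P) * q.
  rewrite {1}Ds /q -scalerAr -big_cat /=; congr (_ *: _).
  by apply: perm_big; rewrite perm_sym (perm_trans (permEl (perm_filterC P s))).
have q0 : q != 0 by apply: contraNneq p0; rewrite pE => ->; rewrite mulr0.
rewrite pE in sp cvp.
have H := @cvg_roots_in_disc (seq.filter P s) N r p_ q sp_ q0 sp cvp (filter_all _ _).
apply: filterS H => t [s' [q' [Ep ss' alls']]].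
have q'0 : q' != 0 by apply: contraNneq (p_0 t); rewrite Ep => ->; rewrite mulr0.
have [u Du] := closed_field_poly_normal q'.
rewrite -size_filter -ss'.
suff /seq.permP -> : perm_eq (R_ t) (s' ++ u).
  by rewrite count_cat (eqP (etrans (esym (all_count _ _)) alls')) leq_addr.
apply: prod_XsubC_eq; apply: (@scalerI _ _ (lead_coef (p_ t))).
  by rewrite lead_coef_eq0.
rewrite -DR {1}Ep Du -scalerAr big_cat /=; congr (_ *: _).
by rewrite Ep lead_coef_monicM ?monic_prod_XsubC.
Qed.
End Filter.
End RootConvergence.

(** * Sorted moduli of the projective zeros *)

Section Reciprocal.
Variable K : idomainType.
Implicit Types p g : {poly K}.

(** This is [X^d p(1/X)]. Reversal at the nominal degree [d], rather than at the actual degree of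
    [p], turns zeros at infinity into zeros at 0. *)
Definition reciprocal d p : {poly K} := \poly_(i < d.+1) p`_(d - i).

Lemma coef_reciprocal d p i :
  (reciprocal d p)`_i = if (i <= d)%N then p`_(d - i) else 0.
Proof. by rewrite coef_poly ltnS. Qed.

Lemma reciprocal_eq0 d p : (size p <= d.+1)%N -> (reciprocal d p == 0) = (p == 0).
Proof.
move=> sp; apply/eqP/eqP => [r0|->]; last first.
  by apply/polyP => i; rewrite coef_reciprocal !coef0 if_same.
apply/polyP => i; rewrite coef0; have [di|id] := ltnP d i.
  by rewrite nth_default // (leq_trans sp).
have /polyP /(_ (d - i)%N) := r0.
by rewrite coef_reciprocal leq_subr subKn // coef0.
Qed.

Lemma reciprocalC d c : reciprocal d c%:P = c *: 'X^d.
Proof.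
apply/polyP => i; rewrite coef_reciprocal coefZ coefXn coefC subn_eq0.
by case: ltngtP => _; rewrite ?mulr1 ?mulr0.
Qed.

Lemma reciprocalXsubC d z g : (size g <= d.+1)%N ->
  reciprocal d.+1 (('X - z%:P) * g) = (1 - z *: 'X) * reciprocal d g.
Proof.
move=> sg; apply/polyP => i; rewrite coef_reciprocal !mulrBl mul1r -scalerAl.
rewrite !coefB coefCM coefZ !coefXM !coef_reciprocal.
case: i => [|i] /=; first by rewrite !subn0 mulr0 (nth_default 0 sg) mulr0.
rewrite subSS !ltnS subn_eq0; have [id|di|->] := ltngtP i d.
- by rewrite subnS.
- by rewrite mulr0 subr0.
- by rewrite subnn sub0r.
Qed.

End Reciprocal.

Section Exponents.
Variable R : realType.
Let C : numClosedFieldType := R[i].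
Implicit Types (p q : {poly C}) (z : C) (t : R).

(** For [z = exp(- gamma) exp(- i phi)] this recovers [gamma]; the zero [z = 0] corresponds to
    [gamma = +oo]. *)
Definition neglog (z : C) : \bar R :=
  if z == 0 then +oo%E else (- ln (Normc.normc z))%:E.

Lemma normC_E z : `|z| = (Normc.normc z)%:C :> C.
Proof. by []. Qed.

Lemma normc_gt0 z : z != 0 -> 0 < Normc.normc z.
Proof. by move=> z0; rewrite -ltcR -normC_E normr_gt0. Qed.

Lemma neglog_gt z t : (t%:E < neglog z)%E = (`|z| < (expR (- t))%:C).
Proof.
rewrite /neglog; have [->|z0] := eqVneq z 0.
  by rewrite ltry normr0 ltcR expR_gt0.
by rewrite lte_fin normC_E ltcR ltrNr -ltr_expR lnK // posrE normc_gt0.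
Qed.

Lemma neglogV z : z != 0 -> neglog z^-1 = (- neglog z)%E.
Proof.
move=> z0; rewrite /neglog invr_eq0 (negbTE z0) EFinN; congr (- (_)%:E)%E.
by rewrite Normc.normcV lnV // posrE normc_gt0.
Qed.

Definition root_seq p : seq C := sval (closed_field_poly_normal p).

Lemma root_seqE p : p = lead_coef p *: \prod_(z <- root_seq p) ('X - z%:P).
Proof. exact: (svalP (closed_field_poly_normal p)). Qed.

Lemma mem_root_seq p z : p != 0 -> (z \in root_seq p) = root p z.
Proof.
by move=> p0; rewrite [p in RHS]root_seqE rootZ ?lead_coef_eq0 // root_prod_XsubC.
Qed.

Lemma root_seq_perm c (s : seq C) : c != 0 ->
  perm_eq (root_seq (c *: \prod_(z <- s) ('X - z%:P))) s.
Proof.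
move=> c0; apply: prod_XsubC_eq; apply: (scalerI c0).
rewrite [RHS]root_seqE lead_coefZ (monicP (monic_prod_XsubC _ _ _)) mulr1.
by [].
Qed.

Lemma size_root_seq p : p != 0 -> size p = (size (root_seq p)).+1.
Proof.
by move=> p0; rewrite {1}(root_seqE p) size_scale ?lead_coef_eq0 // size_prod_XsubC.
Qed.

(* The values [- ln |z|] over the [d] zeros on the projective line of a polynomial
   regarded as a binary form of degree [d]: a drop of the degree contributes zeros at infinity. *)
Definition exponents d p : seq (\bar R) :=
  map neglog (root_seq p) ++ nseq (d - size (root_seq p)) -oo%E.

Lemma size_exponents d p : p != 0 -> (size p <= d.+1)%N -> size (exponents d p) = d.
Proof.
by move=> p0; rewrite size_root_seq // ltnS size_cat size_map size_nseq => /subnKC.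
Qed.

Lemma count_exponents_gt d p t :
  count (fun x => t%:E < x)%E (exponents d p) =
  count (fun z => `|z| < (expR (- t))%:C) (root_seq p).
Proof.
rewrite count_cat count_map count_nseq ltNge leNye mul0n addn0.
by apply: eq_count => z /=; rewrite neglog_gt.
Qed.

Lemma exponents_XsubC d p c w : p != 0 -> c != 0 ->
  perm_eq (exponents d.+1 (c *: (('X - w%:P) * p))) (neglog w :: exponents d p).
Proof.
move=> p0 c0; have P : perm_eq (root_seq (c *: (('X - w%:P) * p))) (w :: root_seq p).
  rewrite {1}(root_seqE p) -scalerAr scalerA -(big_cons _ _ _ _ xpredT (fun z => 'X - z%:P)).
  by rewrite root_seq_perm // mulf_neq0 // lead_coef_eq0.
rewrite /exponents (perm_size P) -cat_cons perm_cat2r.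
exact: (perm_map neglog P).
Qed.

Lemma exponentsS d p : p != 0 -> (size p <= d.+1)%N ->
  perm_eq (exponents d.+1 p) (-oo%E :: exponents d p).
Proof.
move=> p0; rewrite size_root_seq // /exponents => sp; rewrite subSn //=.
exact: (permEl (perm_catCA _ [:: -oo%E] _)).
Qed.

Lemma exponentsC d c : c != 0 -> exponents d c%:P = nseq d -oo%E.
Proof.
move=> c0; have /perm_size /= := root_seq_perm [::] c0.
rewrite big_nil alg_polyC => /size0nil E.
by rewrite /exponents E /= subn0.
Qed.

Lemma exponentsXn d c : c != 0 -> perm_eq (exponents d (c *: 'X^d)) (nseq d +oo%E).
Proof.
move=> c0; have -> : 'X^d = \prod_(z <- nseq d 0) ('X - z%:P) :> {poly C}.
  by rewrite big_nseq subr0 -Monoid.iteropE.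
have P := root_seq_perm (nseq d 0) c0.
rewrite /exponents (perm_size P) size_nseq subnn cats0.
by rewrite (permPl (perm_map _ P)) map_nseq /neglog eqxx.
Qed.

(** The map [z -> 1/z] of the projective line negates [- ln |z|] and exchanges 0 and infinity. The
    induction removes one root of [p] at a time, each turning into a factor [1 - z X] of the
    reciprocal. *)
Lemma exponents_reciprocal d p : p != 0 -> (size p <= d.+1)%N ->
  perm_eq (exponents d (reciprocal d p)) (map oppe (exponents d p)).
Proof.
move=> p0; rewrite (root_seqE p).
have : lead_coef p != 0 by rewrite lead_coef_eq0.
move: (lead_coef p) (root_seq p) => c s {p p0} c0.
elim: s d => [|z s IH] d.
  rewrite big_nil alg_polyC reciprocalC exponentsC // map_nseq => _.
  exact: exponentsXn.
rewrite big_cons; set g := \prod_(z <- s) ('X - z%:P) in IH *.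
have g0 : g != 0 by rewrite monic_neq0 // monic_prod_XsubC.
have cg0 : c *: g != 0 by rewrite scale_poly_eq0 negb_or c0.
rewrite size_scale // size_monicM ?monicXsubC // size_XsubC /= ltnS => sg.
case: d sg => [|d] sg; first by rewrite leqn0 size_poly_eq0 (negbTE g0) in sg.
have scg : (size (c *: g) <= d.+1)%N by rewrite size_scale.
rewrite (permPr (perm_map oppe (exponents_XsubC d z g0 c0))) /=.
have E : perm_eq (exponents d g) (exponents d (c *: g)).
  have P : perm_eq (root_seq (c *: g)) (root_seq g).
    rewrite {1}(root_seqE g) scalerA root_seq_perm // mulf_neq0 //.
    by rewrite lead_coef_eq0.
  rewrite /exponents (perm_size P) perm_cat2r perm_sym.
  exact: perm_map P.
rewrite (permPr (perm_cat (perm_refl [:: _]) (perm_map oppe E))) /=.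
rewrite scalerAr reciprocalXsubC //; set q := reciprocal d (c *: g).
have q0 : q != 0 by rewrite reciprocal_eq0.
have sq : (size q <= d.+1)%N by exact: size_poly.
(* For [z = 0] the factor [1 - z X] is 1: the nominal degree grows but the actual one does not,
   which adds the exponent [-oo]. Otherwise it is [- z (X - 1/z)]. *)
have [->|z0] := eqVneq z 0.
  rewrite scale0r subr0 mul1r /neglog eqxx /=.
  rewrite (permPl (exponentsS q0 sq)) perm_cons.
  by apply: IH; rewrite size_scale.
have -> : (1 - z *: 'X) * q = (- z) *: (('X - z^-1%:P) * q).
  rewrite -!mul_polyC mulrA; congr (_ * _).
  by rewrite polyCN mulNr mulrBr -polyCM divff // opprB polyC1.
rewrite (permPl (exponents_XsubC _ _ q0 _)) ?oppr_eq0 // neglogV // perm_cons.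
by apply: IH; rewrite size_scale.
Qed.

(** Exponents below [t] belong to zeros near infinity, possibly at infinity itself; as small zeros
    of the reciprocal they are within reach of the disc count. *)
Lemma count_exponents_lt d p t : p != 0 -> (size p <= d.+1)%N ->
  count (fun x => x < t%:E)%E (exponents d p) =
  count (fun z => `|z| < (expR t)%:C) (root_seq (reciprocal d p)).
Proof.
move=> p0 sp; have := count_exponents_gt d (reciprocal d p) (- t).
rewrite opprK => <-; rewrite (seq.permP (exponents_reciprocal p0 sp)) count_map.
by apply: eq_count => x /=; rewrite EFinN lteN2.
Qed.

Definition sorted_exponent d p l : \bar R := nth 0%E (sort <=%O (exponents d p)) l.

(** The entry of index [l] exceeds [t] when at most [l] of the [d] entries are [<= t]. In this form
    the condition is a lower bound on a count, hence survives when the count grows. *)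
Lemma sorted_exponent_gt d p l t : p != 0 -> (size p <= d.+1)%N -> (l < d)%N ->
  (t%:E < sorted_exponent d p l)%E =
  (d <= l + count (fun x => t%:E < x)%E (exponents d p))%N.
Proof.
move=> p0 sp ld; set s := sort <=%O (exponents d p).
have ss : sorted <=%O s by exact: sort_le_sorted.
have sz : size s = d by rewrite size_sort size_exponents.
have -> : count (fun x => t%:E < x)%E (exponents d p) = count (fun x => t%:E < x)%E s.
  by apply/esym/seq.permP; rewrite perm_sort.
have cd := count_predC (fun x => x <= t%:E)%E s; rewrite sz in cd.
rewrite (eq_count (a2 := predC (fun x => x <= t%:E)%E)) => [|x]; last by rewrite /= ltNge.
rewrite -{2}cd leq_add2r; have [le|lt] := leqP (count (fun x => x <= t%:E)%E s) l.
  by apply: nth_count_gt => //; rewrite le sz.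
by apply/negbTE; rewrite -leNgt; exact: nth_count_le.
Qed.

Lemma sorted_exponent_lt d p l t : p != 0 -> (size p <= d.+1)%N -> (l < d)%N ->
  (sorted_exponent d p l < t%:E)%E =
  (l < count (fun x => x < t%:E)%E (exponents d p))%N.
Proof.
move=> p0 sp ld; set s := sort <=%O (exponents d p).
have ss : sorted <=%O s by exact: sort_le_sorted.
have sz : size s = d by rewrite size_sort size_exponents.
have -> : count (fun x => x < t%:E)%E (exponents d p) = count (fun x => x < t%:E)%E s.
  by apply/esym/seq.permP; rewrite perm_sort.
have [le|lt] := leqP (count (fun x => x < t%:E)%E s) l.
  by apply/negbTE; rewrite -leNgt; apply: nth_count_ge => //; rewrite le sz.
exact: nth_count_lt.
Qed.

Lemma mem_sorted_exponent d p x : p != 0 -> (size p <= d.+1)%N ->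
  (exists l : 'I_d, sorted_exponent d p l = x) <-> x \in exponents d p.
Proof.
move=> p0 sp; rewrite -(mem_sort <=%O).
have sz : size (sort <=%O (exponents d p)) = d by rewrite size_sort size_exponents.
split=> [[l <-]|/(nthP 0%E)[l]]; first by rewrite mem_nth // sz.
by rewrite sz => ld <-; exists (Ordinal ld).
Qed.

End Exponents.

Lemma cvg_ereal (R : realType) (T : Type) (F : set_system T) (FF : Filter F)
    (f : T -> \bar R) (x : \bar R) :
  (forall t : R, (t%:E < x)%E -> \forall u \near F, (t%:E < f u)%E) ->
  (forall t : R, (x < t%:E)%E -> \forall u \near F, (f u < t%:E)%E) ->
  f @ F --> x.
Proof.
move=> lo hi; case: x lo hi => [r||] lo hi A.
- move=> nA; have /nbhs_ballP[e /= e0 Ae] : nbhs r (fun y => A y%:E) := nA.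
  have lo1 := lo (r - e); have hi1 := hi (r + e).
  rewrite lte_fin gtrBl in lo1; rewrite lte_fin ltrDl in hi1.
  apply: filterS2 (lo1 e0) (hi1 e0) => u.
  rewrite /preimage /=; case: (f u) => [y||] //; rewrite !lte_fin => ry yr.
  by apply: Ae; rewrite -ball_normE /= ltr_distlC ry yr.
- move=> [M [_ MA]]; apply: filterS (lo M (ltry _)) => u; exact: MA.
- move=> [M [_ MA]]; apply: filterS (hi M (ltNyr _)) => u; exact: MA.
Qed.

(** Both one-sided estimates on the [l]-th exponent are lower bounds on numbers of zeros in an open
    disc, for the polynomial and for its reciprocal, and such numbers do not drop near the limit. *)
Lemma cvg_sorted_exponent (R : realType) (T : Type) (F : set_system T)
    (FF : Filter F) d (p_ : T -> {poly R[i]}) (p : {poly R[i]}) l :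
  (forall t, (size (p_ t) <= d.+1)%N) -> (size p <= d.+1)%N ->
  (forall t, p_ t != 0) -> p != 0 ->
  (forall i, (p_ t)`_i @[t --> F] --> (p`_i : (R[i] : numClosedFieldType))) ->
  (l < d)%N ->
  sorted_exponent d (p_ t) l @[t --> F] --> sorted_exponent d p l.
Proof.
move=> sp_ sp p_0 p0 cvp ld; apply: cvg_ereal => t.
  rewrite sorted_exponent_gt // count_exponents_gt => le.
  have := cvg_root_count (expR (- t))%:C sp_ p0 sp cvp p_0
    (fun t => root_seqE (p_ t)) (root_seqE p).
  move=> /(_ FF); apply: filterS => u le2; rewrite sorted_exponent_gt // count_exponents_gt.
  by rewrite (leq_trans le) // leq_add2l.
rewrite sorted_exponent_lt // count_exponents_lt // => lt.
have cvr i : (reciprocal d (p_ t))`_i @[t --> F] -->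
    ((reciprocal d p)`_i : (R[i] : numClosedFieldType)).
  rewrite coef_reciprocal; under eq_fun do rewrite coef_reciprocal.
  case: ifP => _; first exact: cvp.
  exact: (@cvg_cst (R[i] : numClosedFieldType)).
have r0 : reciprocal d p != 0 by rewrite reciprocal_eq0.
have r_0 u : reciprocal d (p_ u) != 0 by rewrite reciprocal_eq0.
have := cvg_root_count (expR t)%:C (fun u => size_poly _ _) r0 (size_poly _ _)
  cvr r_0 (fun u => root_seqE _) (root_seqE _).
move=> /(_ FF); apply: filterS => u le2; rewrite sorted_exponent_lt // count_exponents_lt //.
exact: leq_trans le2.
Qed.

(** * The bivariate characteristic polynomial *)

Section RowDegree.
Variable K : comNzRingType.

Lemma size_coefM_le (p q : {poly K}) a b :
  (size p <= a.+1)%N -> (size q <= b.+1)%N ->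
  (size (p * q)%R <= (a + b).+1)%N /\ (p * q)`_(a + b) = p`_a * q`_b.
Proof.
move=> sp sq; split.
  by have := size_polyMleq p q; lia.
have ab : (a < (a + b).+1)%N by rewrite ltnS leq_addr.
rewrite coefM (bigD1 (Ordinal ab)) //= addKn big1 ?addr0 // => i.
rewrite -val_eqE /= neq_ltn => /orP[lt|lt].
  rewrite (nth_default 0 (leq_trans sq _)) ?mulr0 //.
  by lia.
by rewrite (nth_default 0 (leq_trans sp lt)) mul0r.
Qed.

Lemma size_coef_prod_le (I : Type) (r : seq I) (p : I -> {poly K}) (e : I -> nat) :
  (forall i, (size (p i) <= (e i).+1)%N) ->
  (size (\prod_(i <- r) p i)%R <= (\sum_(i <- r) e i).+1)%N /\
  (\prod_(i <- r) p i)`_(\sum_(i <- r) e i) = \prod_(i <- r) (p i)`_(e i).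
Proof.
move=> sp; elim: r => [|i r [IH1 IH2]].
  by rewrite !big_nil size_poly1 coef1.
by rewrite !big_cons; have [? ->] := size_coefM_le (sp i) IH1; rewrite IH2.
Qed.

(** Each term of the Leibniz expansion takes one entry from each row, so the row bounds [e i] add
    up, and the coefficient at the total degree collects the coefficients at the row bounds. *)
Lemma size_coef_det_le n (M : 'M[{poly K}]_n) (e : 'I_n -> nat) :
  (forall i j, (size (M i j) <= (e i).+1)%N) ->
  (size (\det M)%R <= (\sum_i e i).+1)%N /\
  (\det M)`_(\sum_i e i) = \det (\matrix_(i, j) (M i j)`_(e i)).
Proof.
move=> sM.
have H (s : {perm 'I_n}) := size_coef_prod_le (index_enum 'I_n) (fun i => sM i (s i)).
have sE (s : {perm 'I_n}) (p : {poly K}) : (-1) ^+ s * p = ((-1) ^+ s) *: p.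
  by case: (odd_perm s); rewrite ?expr0 ?expr1 ?mulN1r ?mul1r ?scaleN1r ?scale1r.
rewrite /determinant; split.
  apply: (leq_trans (size_sum _ _ _)); apply/bigmax_leqP => s _.
  by rewrite sE (leq_trans (size_scale_leq _ _)) // (H s).1.
rewrite coef_sum; apply: eq_bigr => s _.
rewrite sE coefZ (H s).2; congr (_ * _).
by apply: eq_bigr => i _; rewrite mxE.
Qed.

End RowDegree.

Section Pencil.
Variable K : fieldType.

(** The inner variable is the spectral parameter [lam], the outer one the multiplier [y] of [B]; the
    coefficients in [y] are thus polynomials in [lam]. *)
Definition pencil_poly n (A B : 'M[K]_n) : {poly {poly K}} :=
  \det (('X%:P : {poly {poly K}})%:M - map_mx (polyC \o polyC) A
        - 'X *: map_mx (polyC \o polyC) B).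

Lemma pencil_polyE n (A B : 'M[K]_n) (lam y : K) :
  (map_poly (horner_eval lam) (pencil_poly A B)).[y] = \det (lam%:M - A - y *: B).
Proof.
rewrite -[LHS]/((horner_eval y \o map_poly (horner_eval lam)) _) -det_map_mx.
congr (\det _); apply/matrixP => i j; rewrite !mxE /=.
rewrite !rmorphB rmorphM rmorphMn /= !map_polyC /= map_polyX /horner_eval !hornerE.
by rewrite hornerMn !hornerE.
Qed.

Lemma pencil_poly_block m d (A : 'M[K]_(m + d)) (D : 'M[K]_d) :
  let Q := pencil_poly A (block_mx 0 0 0 D) in
  (size Q <= d.+1)%N /\
  forall lam, (Q`_d).[lam] = \det (lam%:M - ulsubmx A) * \det (- D).
Proof.
(* The variable [y] occurs only in the last [d] rows, and there to degree at most 1. *)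
pose e (i : 'I_(m + d)) : nat := (m <= i)%N.
have se : (\sum_i e i)%N = d.
  rewrite big_split_ord /= big1 => [|i _]; last by rewrite /e /= leqNgt ltn_ord.
  by under eq_bigr do rewrite /e /= leq_addr; rewrite sum1_card card_ord.
rewrite /= /pencil_poly; set B := block_mx 0 0 0 D; set M := (_ - _ - _).
have ME i j : M i j = ('X *+ (i == j) - (A i j)%:P)%:P - (B i j)%:P%:P * 'X.
  by rewrite !mxE /= rmorphB rmorphMn /= mulrC.
have B0 i j : B (lshift d i) j = 0.
  by case: (split_ordP j) => k ->; rewrite ?block_mxEul ?block_mxEur mxE.
have sM i j : (size (M i j) <= (e i).+1)%N.
  rewrite ME /e; case: (split_ordP i) => k ->.
    by rewrite B0 mul0r subr0 (leq_trans (size_polyC_leq1 _)).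
  rewrite /= leq_addr; apply: (leq_trans (size_polyD _ _)).
  rewrite geq_max (leq_trans (size_polyC_leq1 _)) //= size_polyN.
  apply: (leq_trans (size_polyMleq _ _)); rewrite size_polyX.
  by rewrite addn2 /= ltnS size_polyC_leq1.
have [] := size_coef_det_le sM; rewrite se => sQ ->; split=> // lam.
rewrite -[LHS]/(horner_eval lam _) -det_map_mx.
(* Upper rows contribute their constant terms and lower rows their coefficients of [y], namely
   [- B]; the result is block upper triangular. *)
rewrite -(det_ublock _ (- ursubmx A)); congr (\det _).
have CE (a b : {poly K}) (k : bool) : (a%:P - b%:P * 'X)`_k = if k then - b else a.
  by rewrite coefB coefMX !coefC; case: k; rewrite ?sub0r ?subr0.
have HE i j : horner_eval lam (M i j)`_(e i) =
    if (m <= i)%N then - B i j else lam *+ (i == j) - A i j.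
  rewrite ME CE /horner_eval; case: ifP => _; first by rewrite hornerN hornerC.
  by rewrite hornerD hornerN hornerMn hornerX hornerC.
apply/matrixP => i j; rewrite mxE [X in _ X = _]mxE [LHS]HE.
case: (split_ordP i) => k ->; case: (split_ordP j) => l -> /=.
- by rewrite [RHS]block_mxEul !mxE leqNgt ltn_ord /= (inj_eq (@lshift_inj _ _)).
- by rewrite [RHS]block_mxEur !mxE leqNgt ltn_ord /= eq_lrshift sub0r.
- by rewrite [RHS]block_mxEdl leq_addr /B block_mxEdl !mxE oppr0.
- by rewrite [RHS]block_mxEdr leq_addr /B block_mxEdr !mxE.
Qed.

End Pencil.

(** * Common zeros of the coefficients *)

Section CommonFactor.
Variable K : fieldType.

(** As long as all coefficients share a zero [w], they can be divided by ['X - w%:P]; this lowers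
    the degree of the leading coefficient, so the process stops. *)
Lemma poly_common_factor (E : {poly {poly K}}) : E != 0 ->
  exists (g : {poly K}) (E' : {poly {poly K}}), [/\ g != 0, E = g *: E' &
    forall w, map_poly (horner_eval w) E' != 0].
Proof.
move: {2}(size _) (leqnn (size (lead_coef E))) => n.
elim: n E => [|n IH] E sE E0.
  by rewrite leqn0 size_poly_eq0 lead_coef_eq0 (negbTE E0) in sE.
have [[w Ew]|no] := pselect (exists w, map_poly (horner_eval w) E = 0); last first.
  exists 1, E; split=> [||w]; rewrite ?oner_eq0 ?scale1r //.
  by apply/eqP => Ew; apply: no; exists w.
have dvd k : ('X - w%:P) %| E`_k.
  by rewrite dvdp_XsubCl; apply/eqP; have /polyP/(_ k) := Ew; rewrite coef_map coef0.
pose E1 : {poly {poly K}} := \poly_(k < size E) (E`_k %/ ('X - w%:P)).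
have EE1 : E = ('X - w%:P) *: E1.
  apply/polyP => k; rewrite coefZ coef_poly; case: ltnP => kE.
    by rewrite mulrC divpK.
  by rewrite nth_default // mulr0.
have E10 : E1 != 0 by apply: contraNneq E0 => E1z; rewrite EE1 E1z scaler0.
have sE1 : (size (lead_coef E1) <= n)%N.
  move: sE; rewrite EE1 lead_coefZ size_monicM ?monicXsubC ?lead_coef_eq0 //.
  by rewrite size_XsubC.
have [g [E' [g0 E1E nz]]] := IH E1 sE1 E10.
exists (('X - w%:P) * g), E'; split=> //.
  by rewrite mulf_neq0 // polyXsubC_eq0.
by rewrite EE1 E1E scalerA.
Qed.

End CommonFactor.

(** * The zeros of the cardinal sine *)

Section Sinc.
Variable R : realType.
Implicit Types (x z rho omega : R).

Lemma sincE x : x * sinc x = sin x.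
Proof.
rewrite /sinc; case: eqP => [->|/eqP x0]; first by rewrite mul0r sin0.
by rewrite mulrC divfK.
Qed.

Lemma sinc_continuous : continuous (@sinc R).
Proof.
move=> x; have [->|x0] := eqVneq x 0; last first.
  have nx : {near nbhs x, (fun y => sin y / y) =1 @sinc R}.
    have : \forall y \near x, y != 0 by exact: (@cvgr_neq0 _ R^o _ _ _ id x cvg_id).
    by apply: filterS => y y0; rewrite /sinc (negbTE y0).
  have sx : sinc x = sin x / x by rewrite /sinc (negbTE x0).
  suff : sinc y @[y --> x] --> sin x / x by rewrite -sx.
  apply: (cvg_trans (near_eq_cvg nx)).
  by apply: cvgM; [exact: continuous_sin|apply: cvgV => //; exact: cvg_id].
have s0 : sinc 0 = 1 :> R by rewrite /sinc eqxx.
apply/continuous_withinNx; rewrite s0.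
(* At 0 the claim is that the difference quotient of [sin] tends to [cos 0 = 1]. *)
have [dsin Dsin] := is_derive_sin (0 : R).
rewrite cos0 in Dsin.
have H : h^-1 *: ((sin \o shift 0) (h *: 1) - sin 0) @[h --> (0:R)^'] -->
  'D_1 sin (0 : R) := dsin.
rewrite Dsin in H; apply: cvg_trans H; apply: near_eq_cvg; near=> h.
rewrite sin0 subr0 /= addr0 [h *: 1]mulr1 /sinc ifN; first exact: mulrC.
by near: h; exact: nbhs_dnbhs_neq.
Unshelve. all: by end_near. Qed.

Lemma sin_eq0_int x : sin x = 0 -> exists k : int, x = k%:~R * pi.
Proof.
have sinDn (y : R) n : sin (y + pi *+ n) = (-1) ^+ n * sin y.
  exact: (alternatingn (@sinDpi R)).
have nat_case (y : R) : 0 <= y -> sin y = 0 -> exists k : int, y = k%:~R * pi.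
  move=> y0 sy; have pi0 := @pi_gt0 R.
  have [n /andP[nl nu]] : exists n : nat, n%:R * pi <= y < n.+1%:R * pi.
    (* Shifting by this multiple of [pi] brings [y] into [[0, pi)], where [sin] vanishes only at
       0. *)
    exists (Num.truncn (y / pi)).
    have /andP[tl tu] : (Num.truncn (y / pi))%:R <= y / pi < (Num.truncn (y / pi)).+1%:R.
      exact: (truncn_itv (divr_ge0 y0 (ltW pi0))).
    by rewrite -ler_pdivlMr // tl /= -ltr_pdivrMr.
  exists n%:Z; apply/eqP; rewrite -subr_eq0; apply/negPn/negP => yn.
  have /sin_gt0_pi : 0 < y - n%:R * pi < pi.
    rewrite lt_neqAle eq_sym yn subr_ge0 nl /= ltrBlDl.
    by move: nu; rewrite -natr1 mulrDl mul1r.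
  suff -> : sin (y - n%:R * pi) = 0 by rewrite ltxx.
  have := sinDn (y - n%:R * pi) n; rewrite {1}mulr_natl subrK sy => /esym/eqP.
  by rewrite mulf_eq0 signr_eq0 /= => /eqP.
have [x0|x0] := leP 0 x; first exact: nat_case.
move=> sx; have [||k kE] := nat_case (- x).
- by rewrite oppr_ge0 ltW.
- by rewrite sinN sx oppr0.
- by exists (- k); rewrite rmorphN mulNr -kE opprK.
Qed.

Lemma sinc_neq0 rho omega : nonresonant rho omega -> sinc (rho * omega) != 0.
Proof.
move=> nr; apply: contraT => /negPn s0.
have : sin (rho * omega) = 0 by rewrite -sincE (eqP s0) mulr0.
move=> /sin_eq0_int[k kE].
have [k0|k0] := eqVneq k 0; last by have := nr _ k0; rewrite kE eqxx.
by move: s0; rewrite kE k0 mul0r /sinc eqxx oner_eq0.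
Qed.

(* [rho omega sinc (rho omega) = cos (rho z) rho (omega - z) sinc (rho (omega - z))],
   and partial fractions remove the division by [omega]. *)
Lemma sinc_simple_zero rho z : 0 < rho -> sinc (rho * z) = 0 ->
  exists u : R -> R, [/\ continuous u, u z != 0 &
    forall omega, sinc (rho * omega) = (omega - z) * u omega].
Proof.
move=> rho0 sz.
have z0 : z != 0.
  by apply: contra_eqN sz => /eqP->; rewrite mulr0 /sinc eqxx oner_eq0.
have sinz : sin (rho * z) = 0 by rewrite -sincE sz mulr0.
pose e := cos (rho * z).
have ee : e * e = 1 by rewrite -expr2 -(cos2Dsin2 (rho * z)) sinz expr0n addr0.
have e0 : e != 0 by apply: contra_eqN ee => /eqP->; rewrite mul0r eq_sym oner_eq0.
pose u omega := (e * sinc (rho * (omega - z)) - sinc (rho * omega)) / z.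
have uE omega : sinc (rho * omega) = (omega - z) * u omega.
  apply: (mulfI z0); apply: (mulfI (lt0r_neq0 rho0)).
  have E : rho * omega * sinc (rho * omega) =
      e * (rho * (omega - z) * sinc (rho * (omega - z))).
    by rewrite !sincE mulrBr sinB sinz mulr0 subr0 -/e [RHS]mulrCA ee mulr1.
  rewrite /u; transitivity (rho * omega * sinc (rho * omega) - rho * (omega - z) * sinc (rho * omega)).
    ring.
  rewrite E; field; exact: z0.
exists u; split=> //; last first.
  by rewrite /u subrr mulr0 sz subr0 mulf_neq0 ?invr_eq0 // mulf_neq0 // /sinc eqxx oner_neq0.
move=> omega; apply: cvgM; last exact: cvg_cst.
have cs f : continuous f -> continuous (fun o : R => sinc (rho * f o)).
  move=> cf o; apply: (@continuous_comp _ _ _ (fun o => rho * f o) (@sinc R)).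
    by apply: cvgM; [exact: cvg_cst|exact: cf].
  exact: sinc_continuous.
apply: cvgB; last by apply: (cs id) => o; exact: cvg_id.
apply: cvgM; first exact: cvg_cst.
by apply: (cs (fun o => o - z)) => o; apply: cvgB; [exact: cvg_id|exact: cvg_cst].
Qed.

(** The zeros are split off one by one; what needs proof is that the quotient by [omega - z] still
    has simple zeros at the other points of [S]. *)
Lemma divide_simple_zeros (S : seq R) (h : R -> R) : uniq S -> continuous h ->
  (forall z, z \in S -> exists u : R -> R, [/\ continuous u, u z != 0 &
     forall omega, h omega = (omega - z) * u omega]) ->
  exists v : R -> R, [/\ continuous v, forall z, z \in S -> v z != 0 &
    forall omega, h omega = \prod_(z <- S) (omega - z) * v omega].
Proof.
elim: S h => [|z S IH] h /= => [_ ch _|/andP[zS uS] ch hS].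
  by exists h; split=> // omega; rewrite big_nil mul1r.
have [u [cu uz hu]] := hS z (mem_head _ _).
have [|v [cv vS uv]] := IH u uS cu.
  move=> w wS; have [v [cv vw hv]] := hS w (mem_behead (s := z :: S) wS).
  have zw : z - w != 0 by rewrite subr_eq0; apply: contraNneq zS => ->.
  have uw : u w = 0.
    apply/eqP; have /eqP := hu w; rewrite hv subrr mul0r eq_sym mulf_eq0.
    by rewrite -(opprB z w) oppr_eq0 (negbTE zw).
  (* From [(omega - z) u = h = (omega - w) v] follows [(omega - w) (u - v) = (z - w) u], so this
     quotient needs no division by [omega - w]. *)
  exists (fun omega => (u omega - v omega) / (z - w)); split.
  - move=> omega; apply: cvgM; last exact: cvg_cst.
    by apply: cvgB; [exact: cu|exact: cv].
  - by rewrite uw sub0r mulf_neq0 ?oppr_eq0 // invr_eq0.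
  - move=> omega; apply: (mulIf zw); rewrite -mulrA divfK //.
    by rewrite [RHS]mulrBr -hv hu; ring.
exists v; split=> //.
- move=> w; rewrite in_cons => /predU1P[->|]; last exact: vS.
  by apply: contraNneq uz => vz; rewrite uv vz mulr0.
- by move=> omega; rewrite big_cons hu uv mulrA.
Qed.

Lemma expi_surj (u : R[i]) : `|u| = 1 -> exists phi, u = expi phi.
Proof.
case: u => a b; rewrite normc_def /= => -[] /(congr1 (fun x => x ^+ 2)).
rewrite expr1n sqr_sqrtr ?addr_ge0 ?sqr_ge0 // => ab.
have a1 : -1 <= a <= 1 by apply/andP; split; nra.
have ca : cos (acos a) = a by rewrite acosK // in_itv.
have sa : sin (acos a) = `|b|.
  by rewrite sin_acos // -ab addrC addKr sqrtr_sqr.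
have [b0|b0] := leP 0 b.
  by exists (acos a); rewrite /expi ca sa ger0_norm.
by exists (- acos a); rewrite /expi cosN sinN ca sa ltr0_norm // opprK.
Qed.

Lemma norm_expi phi : `|expi phi : R[i]| = 1.
Proof. by rewrite normc_def /= cos2Dsin2 sqrtr1. Qed.

End Sinc.

(** * Continuity of the coordinate maps of the complex plane *)

Section ComplexTopology.
Variable R : realType.
Let C : numClosedFieldType := R[i].

(** Radii of balls in [R[i]] are themselves complex; a positive one is real, which reduces estimates
    to [R]. *)
Lemma gt0_complexE (e : C) : 0 < e -> e = (complex.Re e)%:C /\ 0 < complex.Re e.
Proof.
move=> e0; have E : (complex.Re e)%:C = e by rewrite RRe_real // gtr0_real.
by split=> //; rewrite -ltcR E.
Qed.

Lemma real_complex_continuous : continuous (fun x : R => x%:C : C).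
Proof.
move=> x; apply/cvgrPdist_lt => e /gt0_complexE[eE er].
have : \forall y \near x, `|x - y| < complex.Re e by exact: (@cvgr_dist_lt _ _ _ (nbhs x) _ id x (@cvg_id _ _) _ er).
apply: filterS => y; rewrite eE -rmorphB normc_def /= expr0n addr0 sqrtr_sqr.
by rewrite ltcR.
Qed.

Lemma imagE omega : imag omega = 'i * omega%:C :> C.
Proof. by apply/eqP; rewrite eq_complex /=; apply/andP; split; apply/eqP; ring. Qed.

Lemma imag_continuous : continuous (fun omega : R => imag omega : C).
Proof.
rewrite (_ : (fun _ => _) = (fun omega : R => 'i * omega%:C : C)); last first.
  by apply/funext => omega; exact: imagE.
by move=> x; apply: cvgM; [exact: cvg_cst|exact: real_complex_continuous].
Qed.

Lemma Re_continuous : continuous (fun z : C => complex.Re z).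
Proof.
move=> x; apply/(@cvgrPdist_lt _ _ _ (nbhs x) (nbhs_filter x)) => e e0.
have ec : 0 < e%:C :> C by rewrite ltcR.
have : \forall y \near x, `|x - y| < e%:C by exact: (@cvgr_dist_lt _ _ _ (nbhs x) _ id x (@cvg_id _ _) _ ec).
apply: (@filterS _ (nbhs x) _) => y; rewrite -raddfB -ltcR => /le_lt_trans; apply.
exact: normc_ge_Re.
Qed.

Lemma Im_continuous : continuous (fun z : C => complex.Im z).
Proof.
have ImE (z : C) : complex.Im z = complex.Re (- 'i * z).
  by case: z => a b /=; ring.
move=> x; have /funext -> : (fun z : C => complex.Im z) =1 (fun z => complex.Re (- 'i * z)) := ImE.
apply: (@continuous_comp _ _ _ (fun z : C => - 'i * z) (fun z : C => complex.Re z)).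
  exact: (@mulrl_continuous C (- 'i) x).
exact: Re_continuous.
Qed.

End ComplexTopology.

(** * Spectral curves *)

Section Family.
Variable R : realType.
Let C : numClosedFieldType := R[i].

Lemma char_poly_det (K : fieldType) n (M : 'M[K]_n) z :
  (char_poly M).[z] = \det (z%:M - M).
Proof.
rewrite -[LHS]/(horner_eval z _) -det_map_mx; congr (\det _).
by apply/matrixP => i j; rewrite !mxE /= /horner_eval hornerD hornerN hornerMn hornerX hornerC.
Qed.

Lemma spectrumE n (M : 'M[R]_n) z :
  spectrum M z <-> \det (z%:M - complexify M) = 0.
Proof.
by rewrite /spectrum /= eigenvalue_root_char rootE char_poly_det; split=> /eqP.
Qed.

Lemma p_0 n rho (A B : 'M[R]_n) omega :
  p_ rho A B omega 0 = \det ((imag omega)%:M - complexify A).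
Proof. by rewrite /p_ mul0r scale0r subr0. Qed.

Lemma p_pencil n rho (A B : 'M[R]_n) omega x :
  p_ rho A B omega x = (map_poly (horner_eval (imag omega))
    (pencil_poly (complexify A) (complexify B))).[x * (sinc (rho * omega))%:C].
Proof. by rewrite pencil_polyE. Qed.

Lemma horner_continuous (p : {poly C}) : continuous (fun z : C => p.[z]).
Proof.
elim/poly_ind: p => [|p c IH].
  have /funext -> : (fun z : C => (0 : {poly C}).[z]) =1 (fun=> 0) by exact: horner0.
  exact: cst_continuous.
have /funext -> : (fun z : C => (p * 'X + c%:P).[z]) =1 (fun z => p.[z] * z + c).
  by move=> z; rewrite hornerMXaddC.
move=> z; apply: (@cvgD C C C (nbhs z) _ (fun z => p.[z] * z) (fun=> c)); last exact: cvg_cst.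
by apply: (@cvgM C C (nbhs z) _ (fun z => p.[z]) id); [exact: IH|exact: cvg_id].
Qed.

(* Dividing the coefficients by their common factor [g] is what extends the curves continuously
   through the frequencies at which [p_ rho A B omega] vanishes identically. *)
Lemma characteristic_family m d rho (A : 'M[R]_(m + d)) (D : 'M[R]_d) : 0 < rho ->
  let B := block_mx 0 0 0 D in
  exists (g : {poly C}) (f : R -> {poly C}),
  [/\ g != 0, forall omega, (size (f omega) <= d.+1)%N /\ f omega != 0,
      forall k, continuous (fun omega => (f omega)`_k : C),
      forall omega x, p_ rho A B omega x = g.[imag omega] * (f omega).[x] &
      forall omega, g.[imag omega] * (f omega)`_d =
        \det ((imag omega)%:M - complexify (ulsubmx A)) * \det (- complexify D)
          * (sinc (rho * omega))%:C ^+ d].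
Proof.
move=> rho0 B; pose Q := pencil_poly (complexify A) (complexify B).
have BE : complexify B = block_mx 0 0 0 (complexify D).
  by rewrite /complexify map_block_mx !map_mx0.
have [sQ Qd] : (size Q <= d.+1)%N /\ forall lam, (Q`_d).[lam] =
    \det (lam%:M - ulsubmx (complexify A)) * \det (- complexify D).
  by rewrite /Q BE; exact: pencil_poly_block.
have Q0E lam : (Q`_0).[lam] = \det (lam%:M - complexify A).
  by rewrite -[LHS]/(horner_eval lam _) -coef_map -horner_coef0 pencil_polyE scale0r subr0.
(* The constant coefficient in [y] is the characteristic polynomial of [A]. *)
have Q00 : Q`_0 != 0.
  have /closed_nonrootP[w] := monic_neq0 (char_poly_monic (complexify A)).
  by rewrite rootE char_poly_det -Q0E; apply: contraNneq => ->; rewrite horner0.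
(* A finite set containing every [omega] at which both [sinc (rho * omega)] and [det (i omega - A)]
   vanish. *)
pose S := undup [seq complex.Im z | z <- root_seq Q`_0 & sinc (rho * complex.Im z) == 0].
have SP omega : omega \in S -> sinc (rho * omega) = 0.
  by rewrite mem_undup => /mapP[z]; rewrite mem_filter => /andP[/eqP ? _] ->.
have [||v [cv vS hv]] := @divide_simple_zeros R S (fun omega => sinc (rho * omega))
  (undup_uniq _).
- move=> omega; apply: (@continuous_comp _ _ _ (fun o => rho * o) (@sinc R)).
    by apply: cvgM; [exact: cvg_cst|exact: cvg_id].
  exact: sinc_continuous.
- by move=> z /SP; exact: sinc_simple_zero.
(* The factor [- 'i] undoes the rotation of [imag omega], so that [gS] at [i omega] is the product
   of the [omega - z]. *)
pose gS : {poly C} := \prod_(z <- S) ((- 'i) *: 'X - (z%:C)%:P).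
have gSE omega : gS.[imag omega] = (\prod_(z <- S) (omega - z))%:C.
  rewrite horner_prod rmorph_prod; apply: eq_bigr => z _.
  by rewrite !hornerE imagE mulrA mulNr -expr2 sqrCi opprK mul1r rmorphB.
(* [E(lam, y) = Q(lam, gS(lam) y)], whence [p_omega(x) = E(i omega, v(omega) x)]. Accordingly
   [f omega] below is [E'(i omega, v(omega) x)]. *)
pose E : {poly {poly C}} := \poly_(k < d.+1) (Q`_k * gS ^+ k).
have E0E : E`_0 = Q`_0 by rewrite coef_poly /= expr0 mulr1.
have E0 : E != 0 by apply: contraNneq Q00 => E0; rewrite -E0E E0 coef0.
have [g [E' [g0 EE nz]]] := poly_common_factor E0.
have gE k : (k < d.+1)%N -> g * E'`_k = Q`_k * gS ^+ k.
  by move=> kd; rewrite -coefZ -EE coef_poly kd.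
have sE' : (size E' <= d.+1)%N by rewrite -(size_scale E' g0) -EE size_poly.
pose f omega : {poly C} := \poly_(k < d.+1) ((E'`_k).[imag omega] * (v omega)%:C ^+ k).
have gf omega k : (k < d.+1)%N -> g.[imag omega] * (f omega)`_k =
    (Q`_k).[imag omega] * (sinc (rho * omega))%:C ^+ k.
  move=> kd; rewrite coef_poly kd mulrA -hornerM gE // hornerM horner_exp gSE.
  by rewrite -mulrA -exprMn -rmorphM -hv.
exists g, f; split=> //.
- move=> omega; split; first exact: size_poly.
  apply/negP => /eqP f0.
  have fk0 k : (k < d.+1)%N -> (E'`_k).[imag omega] * (v omega)%:C ^+ k = 0.
    by move=> kd; have /polyP/(_ k) := f0; rewrite coef_poly kd coef0.
  (* If [v omega != 0], all coefficients of [E'] would vanish at [i omega]. If [v omega = 0], then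
     [sinc (rho * omega) = 0] and the vanishing constant coefficient makes [i omega] a zero of the
     characteristic polynomial; so [omega] is in [S], where [v] is nonzero. *)
  have [v0|v0] := eqVneq (v omega) 0; last first.
    have /negP := nz (imag omega); apply; apply/eqP/polyP => k.
    rewrite coef_map coef0 /=; have [kd|kd] := ltnP k d.+1; last first.
      by rewrite nth_default ?(leq_trans sE') // /horner_eval horner0.
    have /eqP := fk0 k kd; rewrite mulf_eq0 expf_eq0 => /orP[/eqP//|].
    by rewrite -(rmorph0 (real_complex R)) (inj_eq (@complexI R)) (negbTE v0) andbF.
  suff /vS : omega \in S by rewrite v0 eqxx.
  have s0 : sinc (rho * omega) = 0 by rewrite hv v0 mulr0.
  rewrite mem_undup; apply/mapP; exists (imag omega) => //.
  rewrite mem_filter /= s0 eqxx mem_root_seq // rootE -E0E EE coefZ hornerM.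
  by have := fk0 0%N isT; rewrite expr0 mulr1 => ->; rewrite mulr0 eqxx.
- move=> k; have [kd|kd] := ltnP k d.+1; last first.
    have /funext -> : (fun omega => (f omega)`_k) =1 (fun=> 0 : C).
      by move=> omega; rewrite nth_default // (leq_trans (size_poly _ _)).
    exact: cst_continuous.
  have /funext -> : (fun omega => (f omega)`_k) =1
      (fun omega => (E'`_k).[imag omega] * (v omega)%:C ^+ k : C).
    by move=> omega; rewrite coef_poly kd.
  move=> omega; apply: cvgM.
    apply: (@continuous_comp _ _ _ (fun o : R => imag o : C) (horner E'`_k)).
      exact: imag_continuous.
    exact: horner_continuous.
  apply: (@continuous_comp _ _ _ (fun o : R => (v o)%:C : C) (fun z => z ^+ k)).
    apply: (@continuous_comp _ _ _ v (fun x : R => x%:C : C)); first exact: cv.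
    exact: real_complex_continuous.
  have /funext <- : (fun z : C => 'X^k.[z]) =1 (fun z => z ^+ k) by move=> z; exact: hornerXn.
  exact: horner_continuous.
- move=> omega x; rewrite p_pencil -/Q.
  rewrite (@horner_coef_wide _ d.+1); last first.
    by rewrite (leq_trans (size_poly _ _)).
  rewrite (@horner_coef_wide _ d.+1 (f omega)) ?size_poly // mulr_sumr.
  apply: eq_bigr => k _; rewrite mulrA gf // coef_map /= /horner_eval exprMn.
  by rewrite mulrCA mulrA [in RHS]mulrAC -mulrA; ring.
- move=> omega; rewrite gf // Qd; congr (\det (_ - _) * _ * _).
  by rewrite /complexify map_ulsubmx.
Qed.
End Family.

Section Membership.
Variable R : realType.
Let C : numClosedFieldType := R[i].
Implicit Types (p : {poly C}) (r : R).

Lemma ninfty_in_neglog (s : seq C) : (-oo%E \in map (@neglog R) s) = false.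
Proof. by apply/mapP => -[z _]; rewrite /neglog; case: ifP. Qed.

Lemma pinfty_exponents d p : p != 0 -> (+oo%E \in exponents d p) = root p 0.
Proof.
move=> p0; rewrite mem_cat mem_nseq andbF orbF -mem_root_seq //.
apply/mapP/idP => [[z zs]|s0]; last by exists 0; rewrite // /neglog eqxx.
by rewrite /neglog; case: eqP => // <-.
Qed.

(** Only the padding of [exponents] contributes [-oo], and it is nonempty exactly when the degree is
    below [d]. *)
Lemma ninfty_exponents d p : p != 0 -> (size p <= d.+1)%N ->
  (-oo%E \in exponents d p) = (p`_d == 0).
Proof.
move=> p0 sp; rewrite mem_cat ninfty_in_neglog mem_nseq eqxx andbT /= subn_gt0.
rewrite -ltnS -size_root_seq //; have [lt|ge] := ltnP (size p) d.+1.
  by rewrite nth_default // eqxx.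
have sE : size p = d.+1 by apply/eqP; rewrite eqn_leq sp.
by rewrite -[d in p`_d]/(d.+1.-1) -sE -/(lead_coef p) lead_coef_eq0 (negbTE p0).
Qed.

Lemma fin_exponents d p r : p != 0 -> (r%:E \in exponents d p) <->
  exists2 z, root p z & `|z| = (expR (- r))%:C.
Proof.
move=> p0; rewrite mem_cat mem_nseq andbF orbF.
have key z : r%:E = neglog z <-> `|z| = (expR (- r))%:C.
  rewrite /neglog; have [->|z0] := eqVneq z 0.
    split=> //; rewrite normr0 => /esym/complexI/eqP.
    by rewrite gt_eqF ?expR_gt0.
  rewrite normC_E; split=> [[->]|/complexI ->].
    by rewrite opprK lnK // posrE normc_gt0.
  by rewrite expRK opprK.
split.
  move=> /mapP[z]; rewrite mem_root_seq // => rz /key; by exists z.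
by move=> [z rz /key ?]; apply/mapP; exists z; rewrite // mem_root_seq.
Qed.

End Membership.

Section SpectralCurves.
Variable R : realType.
Let C : numClosedFieldType := R[i].

(** Along a filter on the curve converging to [z], the common value of [gamma (Im y)] and [Re y]
    tends to both [gamma (Im z)] and [Re z]. Uniqueness of limits in the extended line puts [z] on
    the curve and excludes an infinite [gamma (Im z)]. *)
Lemma spectral_curve_closed (gamma : R -> \bar R) :
  continuous gamma -> closed (spectral_curve gamma : set (Cx R)).
Proof.
move=> cg; apply/closure_id/seteqP; split; first exact: subset_closure.
rewrite closureEcvg => z [F PF [Fz FS]].
have FE : \forall y \near F, gamma (complex.Im y) = (complex.Re y)%:E.
  by apply: FS => y [omega fg <-] /=; rewrite fineK.
have c1 : (gamma (complex.Im y)) @[y --> F] --> gamma (complex.Im z).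
  apply: (@cvg_comp _ _ _ (fun y : Cx R => complex.Im y) gamma F (nbhs (complex.Im z))).
    apply: cvg_trans (@Im_continuous R z); exact: cvg_app.
  exact: cg.
have c2 : (gamma (complex.Im y)) @[y --> F] --> (complex.Re z)%:E.
  have c3 : (complex.Re y)%:E @[y --> F] --> (complex.Re z)%:E.
    apply: cvg_EFin => //.
      by near=> y.
    apply: cvg_trans (@Re_continuous R z); exact: cvg_app.
  apply: cvg_trans c3; apply: near_eq_cvg.
  by apply: filterS FE => y ->.
have E := cvg_unique _ c1 c2.
exists (complex.Im z); rewrite /= E //.
by case: (z).
Unshelve. all: by end_near. Qed.

Lemma near_notin (s : seq R) (x : R) : \forall y \near x^', y \notin s.
Proof.
elim: s => [|a s IH]; first by near=> y.
have na : \forall y \near x^', y != a.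
  have [<-|xa] := eqVneq x a; first exact: nbhs_dnbhs_neq.
  apply: nbhs_dnbhs; rewrite -subr_eq0 in xa.
  have : \forall y \near x, y - a != 0.
    apply: (@cvgr_neq0 _ R^o _ (nbhs x) _ (fun y => y - a) (x - a)) => //.
    by apply: cvgB; [exact: cvg_id|exact: cvg_cst].
  by apply: filterS => y; rewrite subr_eq0.
by apply: filterS2 na IH => y ya ys; rewrite in_cons negb_or ya.
Unshelve. all: by end_near. Qed.



Lemma near_horner_imag_neq0 (g : {poly C}) (omega0 : R) : g != 0 ->
  \forall omega \near omega0^', g.[imag omega] != 0.
Proof.
move=> g0; apply: filterS (near_notin [seq complex.Im z | z <- root_seq g] omega0).
move=> omega; apply: contraNneq => gi; apply/mapP; exists (imag omega) => //.
by rewrite mem_root_seq // rootE gi.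
Qed.

(** Finiteness of [gamma] is an open condition, so a point over [omega0] is a limit of points over
    nearby frequencies other than [omega0], where [P] holds. *)
Lemma spectral_curve_sub_closure (gamma : R -> \bar R) (P : set R) :
  continuous gamma -> (forall omega0, \forall omega \near omega0^', P omega) ->
  spectral_curve gamma `<=` closure
    ([set fine (gamma omega) +i* omega | omega in
       [set omega | P omega /\ gamma omega \is a fin_num]] : set (Cx R)).
Proof.
move=> cg nP z [omega0 fg0 <-] A nA.
have [fin cf] : (\forall omega \near omega0, gamma omega \is a fin_num) /\
    (fine (gamma omega) @[omega --> omega0] --> fine (gamma omega0)).
  by apply/fine_cvgP; rewrite fineK //; exact: cg.
have nb : fine (gamma omega) +i* omega @[omega --> omega0] -->
    (fine (gamma omega0) +i* omega0 : C).
  have E : (fun omega => fine (gamma omega) +i* omega : C) =1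
      (fun omega => (fine (gamma omega))%:C + imag omega).
    by move=> omega; apply/eqP; rewrite eq_complex /= addr0 add0r !eqxx.
  rewrite (E omega0) (funext E).
  apply: (@cvgD C C R (nbhs omega0) _ (fun o => (fine (gamma o))%:C) (fun o => imag o));
    last exact: imag_continuous.
  apply: (@cvg_comp _ _ _ (fun o => fine (gamma o)) (fun x : R => x%:C : C) _ _ _ cf).
  exact: real_complex_continuous.
have fA : \forall omega \near omega0^', A (fine (gamma omega) +i* omega).
  by apply: nbhs_dnbhs; exact: nb.
have fin' : \forall omega \near omega0^', gamma omega \is a fin_num.
  exact: nbhs_dnbhs.
have all3 : \forall omega \near omega0^',
    (P omega /\ gamma omega \is a fin_num) /\ A (fine (gamma omega) +i* omega).
  by near=> omega; (do 2?split); near: omega; [exact: nP|exact: fin'|exact: fA].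
have [omega [[Po fo] Ao]] := @filter_ex _ _ (Proper_dnbhs_numFieldType omega0) _ all3.
exists (fine (gamma omega) +i* omega); split; last exact: Ao.
by exists omega.
Unshelve. all: by end_near. Qed.

End SpectralCurves.

Theorem theoremA2 (R : realType) (m d : nat) (rho : R)
    (A B : 'M[R]_(m + d)) (Bbar : 'M[R]_d) :
  (1 <= d)%N ->
  0 < rho ->
  Bbar \in unitmx ->
  B = block_mx 0 0 0 Bbar ->
  d = \rank B ->
  let A1 := ulsubmx A in
  exists gamma : 'I_d -> R -> \bar R,
    [/\ (forall l, continuous (gamma l)) /\
        asymptotic_continuous_spectrum rho A B
          = \bigcup_(l in [set: 'I_d]) spectral_curve (gamma l),
        forall omega : R, regular_frequencies rho A1 omega ->
          (exists l, gamma l omega = +oo%E) <-> spectrum A (imag omega)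
      & forall omega : R,
          ~ spectrum A (imag omega) -> nonresonant rho omega ->
          (d < m + d)%N ->
          (exists l, gamma l omega = -oo%E) <-> spectrum A1 (imag omega)].
Proof.
move=> _ rho0 uB -> _ A1; set B' := block_mx _ _ _ _.
have [g [f [g0 sf cf pf fd]]] := characteristic_family A Bbar rho0.
have s_ omega : (size (f omega) <= d.+1)%N by have [] := sf omega.
have f0 omega : f omega != 0 by have [] := sf omega.
have uB' : \det (- complexify Bbar) != 0.
  rewrite -scaleN1r detZ mulf_neq0 ?expf_neq0 ?oppr_eq0 ?oner_eq0 //.
  by rewrite det_map_mx -(rmorph0 (real_complex R)) (inj_eq (@complexI R)) -unitfE -unitmxE.
have sinc0 omega : nonresonant rho omega -> (sinc (rho * omega))%:C ^+ d != 0 :> R[i].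
  by move=> nr; rewrite expf_neq0 // -(rmorph0 (real_complex R)) (inj_eq (@complexI R)) sinc_neq0.
pose gamma (l : 'I_d) omega := sorted_exponent d (f omega) l.
have gammaP omega x : (exists l, gamma l omega = x) <-> x \in exponents d (f omega).
  exact: mem_sorted_exponent.
have cg l : continuous (gamma l).
  by move=> omega; apply: cvg_sorted_exponent => // i; exact: cf.
have p0E omega : p_ rho A B' omega 0 = 0 <-> spectrum A (imag omega).
  by rewrite p_0; split=> /spectrumE.
exists gamma; split; last 2 first.
- move=> omega [nA1 nr]; rewrite gammaP pinfty_exponents // -p0E pf.
  (* Off the spectrum of [A1] and the resonances the coefficient of [x^d] in [p_omega] is nonzero,
     hence so is its factor [g]; then [p_omega(0)] and [f_omega(0)] vanish together. *)
  have gi : g.[imag omega] != 0.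
    have : g.[imag omega] * (f omega)`_d != 0.
      rewrite fd !mulf_neq0 ?sinc0 //.
      by apply/eqP => e; apply: nA1; apply/spectrumE.
    by apply: contraNneq => ->; rewrite mul0r.
  rewrite rootE; split=> [/eqP ->|/eqP]; first by rewrite mulr0.
  by rewrite mulf_eq0 (negbTE gi).
- move=> omega nA nr _; rewrite gammaP ninfty_exponents //.
  (* Here [g] is a factor of [p_omega(0) = det (i omega - A)], which is nonzero; the degree of
     [f omega] then drops exactly when [det (i omega - A1)] vanishes. *)
  have gi : g.[imag omega] != 0.
    by apply/eqP => gi; apply: nA; apply/p0E; rewrite pf gi mul0r.
  rewrite -(mulrI_eq0 _ (mulfI gi)) fd !mulf_eq0 (negbTE uB') (negbTE (sinc0 _ nr)) !orbF.
  by split=> [/eqP/spectrumE|/spectrumE/eqP].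
split=> //.
have strongE omega :
    strong_critical_spectrum rho A B' (imag omega) <-> g.[imag omega] = 0.
  split=> [[omega' [_ pz] [oE]]|gi]; last first.
    exists omega => //; split; last by move=> x; rewrite pf gi mul0r.
    by apply/p0E; rewrite pf gi mul0r.
  rewrite {}oE in pz; have /closed_nonrootP[x] := f0 omega.
  by rewrite rootE => /negbTE fx; apply/eqP; have /eqP := pz x; rewrite pf mulf_eq0 fx orbF.
(* Before closure, the spectrum consists of the curves restricted to frequencies with
   [g(i omega) != 0]. *)
have S0E (z : Cx R) : (exists gamma0 omega : R,
    [/\ z = gamma0 +i* omega, ~ strong_critical_spectrum rho A B' (imag omega) &
     exists phi : R, p_ rho A B' omega ((expR (- gamma0))%:C * expi (- phi)) = 0]) <->
    exists l, [set fine (gamma l omega) +i* omega | omega in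
       [set omega | g.[imag omega] != 0 /\ gamma l omega \is a fin_num]] z.
  split.
    move=> [a [omega [-> ns [phi pz]]]].
    have gi : g.[imag omega] != 0 by apply/eqP => gi; apply: ns; apply/strongE.
    have : a%:E \in exponents d (f omega).
      apply/fin_exponents => //; exists ((expR (- a))%:C * expi (- phi)).
        by move/eqP: pz; rewrite pf mulf_eq0 (negbTE gi) rootE.
      by rewrite normrM norm_expi mulr1 gtr0_norm // ltcR expR_gt0.
    by move=> /gammaP[l lE]; exists l, omega; rewrite /= ?lE.
  move=> [l [omega [/= gi fin] <-]]; exists (fine (gamma l omega)), omega; split=> //.
    by move=> /strongE/eqP; rewrite (negbTE gi).
  have : (fine (gamma l omega))%:E \in exponents d (f omega).
    by rewrite fineK //; apply/gammaP; exists l.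
  move=> /fin_exponents[] // w rz zE; set e := (expR _)%:C in zE *.
  have e0 : e != 0 by rewrite gt_eqF // ltcR expR_gt0.
  (* The root [w] has modulus [e], so [w / e] lies on the unit circle and its argument supplies the
     phase, up to sign. *)
  have [|phi phiE] := @expi_surj R (w / e).
    by rewrite normrM normfV zE gtr0_norm ?divff // ltcR expR_gt0.
  exists (- phi); rewrite opprK -phiE mulrC divfK // pf.
  by rewrite (eqP rz) mulr0.
(* One inclusion holds because a finite union of closed curves is closed, the other because each
   curve lies in the closure of its restricted part. *)
apply/seteqP; split.
  have clU : closed (\bigcup_(l in [set: 'I_d]) spectral_curve (gamma l) : set (Cx R)).
    apply: closed_bigcup => [|l _]; first exact: finite_finset.
    exact: spectral_curve_closed.
  rewrite [X in _ `<=` X]((closure_id _).1 clU); apply: closure_subset => z /S0E[l [omega [_ fin] <-]].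
  by exists l => //; exists omega.
move=> z [l _ lz].
have := spectral_curve_sub_closure (cg l) (fun o => near_horner_imag_neq0 o g0) lz.
by apply: closure_subset => {lz}z lz; apply/S0E; exists l.
Qed.
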